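(* For each integer $n\geq 1$ let $Q_{n-1}$ be a polynomial of degree at most $n-1$ satisfying conditions (i) and (ii) of the context, let $x_{n,0},\dots,x_{n,n}$ be the associated nodes and let $R_n:C[0,1]\to C[0,1]$ be the associated rational Bernstein operator. Then $R_n$ converges to the identity operator as $n\to\infty$ (that is, $R_nf\to f$ uniformly on $[0,1]$ for every $f\in C[0,1]$) if and only if $$\Delta_n:=\sup_{0\leq k\leq n-1}\left|x_{n,k+1}-x_{n,k}\right|$$ converges to $0$ as $n\to\infty$.
   Context: $C[0,1]$ is the space of continuous real-valued functions on $[0,1]$. Let $n\geq 1$ and let $Q_{n-1}$ be a polynomial of degree at most $n-1$, strictly positive on $[0,1]$. Write $Q_{n-1}(x)=\sum_{k=0}^{n-1}\gamma_{n-1,k}\,x^k(1-x)^{n-1-k}$ and $\gamma_{n-1,k}=w_{n-1,k}\binom{n-1}{k}$, so that the $w_{n-1,k}$ are the Bernstein coefficients of $Q_{n-1}$. Conditions: (i) $w_{n-1,k}>0$ for $k=0,\dots,n-1$; (ii) property (W): $\frac{w_{n-1,k-1}w_{n-1,k+1}}{w_{n-1,k}^2}<\frac{k+1}{k}\cdot\frac{n-k}{n-k-1}$ for $k=1,\dots,n-2$ (equivalently, $\gamma_{n-1,k-1}/\gamma_{n-1,k}$ is strictly increasing in $k=1,\dots,n-1$). Convention: $\gamma_{n-1,-1}=\gamma_{n-1,n}=0$. The nodes are $x_{n,k}=\frac{\gamma_{n-1,k-1}}{\gamma_{n-1,k}+\gamma_{n-1,k-1}}$ for $k=0,\dots,n$;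 under (i) and (ii) one has $0=x_{n,0}<x_{n,1}<\dots<x_{n,n}=1$. The rational Bernstein operator associated with $Q_{n-1}$ is $$R_nf(x)=\sum_{k=0}^{n}f(x_{n,k})\,(\gamma_{n-1,k}+\gamma_{n-1,k-1})\,\frac{x^k(1-x)^{n-k}}{Q_{n-1}(x)},$$ which reproduces the functions $1$ and $x$. *)

(* Defs.v *)
From HB Require Import structures.
From mathcomp Require Import all_boot all_order all_algebra.
From mathcomp Require Import all_classical all_reals all_analysis.

Set Implicit Arguments.
Unset Strict Implicit.
Unset Printing Implicit Defensive.

Import Order.TTheory GRing.Theory Num.Theory.
Import numFieldNormedType.Exports.

Local Open Scope classical_set_scope.
Local Open Scope ring_scope.

(* [w m k] is the [k]-th Bernstein coefficient of the polynomial [Q m] of degree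
   at most [m]. The operator of order [n >= 1] is built from [Q n.-1]; the values
   of the definitions below at [n = 0] carry no meaning. *)

(* The coefficients [w m 0], ..., [w m m] are determined by [Q m] when
   [size (Q m) <= m.+1]; [w m k] is unconstrained for [k > m]. *)
Definition bernstein_coefs (R : realType) (m : nat) (q : {poly R})
    (c : nat -> R) : Prop :=
  q = \sum_(k < m.+1) (c k * 'C(m, k)%:R) *: ('X^k * (1 - 'X) ^+ (m - k)).

(* Since ['C(m, m.+1) = 0], the convention gamma_(m, m+1) = 0 is built in. *)
Definition bern_gamma (R : realType) (w : nat -> nat -> R) (m k : nat) : R :=
  w m k * 'C(m, k)%:R.

(* gamma_(m, k-1), with the convention gamma_(m, -1) = 0. *)
Definition bern_gamma_pred (R : realType) (w : nat -> nat -> R) (m k : nat) : R :=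
  if k is j.+1 then bern_gamma w m j else 0.

Definition rbern_node (R : realType) (w : nat -> nat -> R) (n k : nat) : R :=
  bern_gamma_pred w n.-1 k / (bern_gamma w n.-1 k + bern_gamma_pred w n.-1 k).

(* Only the values of [f] on [0, 1] are used, the nodes being in [0, 1]. *)
Definition rbern_op (R : realType) (Q : nat -> {poly R}) (w : nat -> nat -> R)
    (n : nat) (f : R -> R) (x : R) : R :=
  \sum_(k < n.+1)
    f (rbern_node w n k) * (bern_gamma w n.-1 k + bern_gamma_pred w n.-1 k)
    * (x ^+ k * (1 - x) ^+ (n - k) / (Q n.-1).[x]).

Definition property_W (R : realType) (w : nat -> nat -> R) (n : nat) : Prop :=
  forall k : nat, (1 <= k <= n - 2)%N ->
    w n.-1 k.-1 * w n.-1 k.+1 / w n.-1 k ^+ 2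
    < (k.+1%:R / k%:R) * ((n - k)%:R / (n - k - 1)%:R).

Definition node_gap (R : realType) (w : nat -> nat -> R) (n : nat) : R :=
  sup [set `|rbern_node w n k.+1 - rbern_node w n k| | k in `I_n].

(* Main.v *)
Require Import Defs.
From mathcomp Require Import all_boot all_order all_algebra.
From mathcomp Require Import all_classical all_reals all_analysis.
From mathcomp Require Import ring lra.
Import Order.TTheory GRing.Theory Num.Theory.
Import numFieldNormedType.Exports.
Local Open Scope classical_set_scope.
Local Open Scope ring_scope.

(** Write [b_k(x) = gamma_k x^k (1-x)^(n-1-k) / Q(x)] and let [p_k(x)] be the
    weight of [f(x_k)] in [R_n f(x)]. For fixed [x] in [[0, 1]] both families
    are probability distributions, and the nodes are exactly what makes

      [x_k p_k(x) = x b_(k-1)(x)]  and  [(1 - x_k) p_k(x) = (1-x) b_k(x)].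

    The operator [R_n] therefore averages [f] against a distribution of mean
    [x], and everything is governed by the variance
    [V_n(x) = sum_k (x_k - x)^2 p_k(x) = R_n(t^2)(x) - x^2]. Summing the two
    relations against [x_k] gives the closed form ([rbern_varianceE])

      [V_n(x) = x (1-x) sum_(k<n) (x_(k+1) - x_k) b_k(x)].

    If the gaps tend to 0, then [V_n <= Delta_n / 4] tends to 0 uniformly. A
    continuous [f] satisfies [|f s - f t| <= e + C (s-t)^2] on [[0, 1]] for
    every [e > 0] and a suitable [C] ([quadratic_modulus]), and averaging this
    bound yields [|f - R_n f| <= e + C V_n], as in Korovkin's theorem.

    Conversely, test the convergence on [t^2], where the error is [V_n]. By
    property (W) the nodes increase, so no node lies inside a gap, and at the
    midpoint of a gap of length [l] every node is at distance at least [l / 2].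
    Hence [V_n >= (l / 2)^2] there, and uniform smallness of [V_n] forces all
    the gaps to be small. *)

(** * Continuous functions on the unit interval *)

Section ContinuousFunctions.
Set Implicit Arguments.
Unset Strict Implicit.
Context (R : realType).

(** Where [|s - t|] is small, uniform continuity bounds the left side by [e];
    elsewhere the quadratic term exceeds twice a bound of [|f|] once [C] is
    large. Compactness is used once, through near-coverings, to choose the same
    [C] for all [s], which gives uniform continuity on the way. *)
Lemma quadratic_modulus (f : R -> R) (e : R) :
  {within `[0, 1], continuous f} -> 0 < e ->
  exists2 C : R, 0 <= C & forall s t : R, 0 <= s <= 1 -> 0 <= t <= 1 ->
    `|f s - f t| <= e + C * (s - t) ^+ 2.
Proof.
move=> fcont e0.
have [M M0 fM] : exists2 M : R, 0 <= M &
    forall t, 0 <= t <= 1 -> `|f t| <= M.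
  have /compact_bounded := continuous_compact fcont (@segment_compact R 0 1).
  move=> [M [_ hM]]; exists (`|M| + 1); first by rewrite addr_ge0.
  move=> t t01; apply: (hM (`|M| + 1)).
    by rewrite (le_lt_trans (ler_norm M))// ltrDl.
  by exists t => //=; rewrite in_itv.
have /compact_near_coveringP/near_covering_withinP cov :=
  @segment_compact R 0 1.
have : \forall C \near +oo%R, `[0, 1] `<=` (fun s => forall t, 0 <= t <= 1 ->
    `|f s - f t| <= e + C * (s - t) ^+ 2).
  apply: cov => s0 s01.
  have /subspace_continuousP/(_ s0 s01)/cvgrPdist_lt/(_ (e / 2)) := fcont.
  rewrite divr_gt0// => /(_ isT).
  rewrite near_withinE => /nbhs_ballP[d /= d0 hd].
  have fd u : 0 <= u <= 1 -> `|s0 - u| < d -> `|f s0 - f u| < e / 2.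
    by move=> u01 ud; apply: hd => //=; rewrite in_itv.
  (* If [|s - s0| < d / 2], then [|s - t| < d / 2] puts both [s] and [t] in the
     [d]-ball of [s0]; otherwise [C * (s - t) ^+ 2 >= 2 * M]. *)
  exists (ball s0 (d / 2), [set C | 8 * M / d ^+ 2 < C]).
    split; first by apply: nbhsx_ballx; rewrite divr_gt0.
    by apply: nbhs_pinfty_gt; rewrite num_real.
  move=> [s C] /= [sd hC]; rewrite in_itv /= => s01' t t01.
  rewrite /ball/= in sd.
  have C0 : 0 <= C.
    apply: le_trans (ltW hC).
    by rewrite divr_ge0 ?mulr_ge0 ?exprn_ge0 ?(ltW d0).
  have [std|std] := ltP `|s - t| (d / 2).
    have s0t : `|s0 - t| < d.
      have := ler_distD s s0 t; lra.
    have s0s : `|s0 - s| < d by lra.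
    have h1 := fd t t01 s0t; have h2 := fd s s01' s0s.
    have := ler_distD (f s0) (f s) (f t); rewrite (distrC (f s) (f s0)).
    have : 0 <= C * (s - t) ^+ 2 by rewrite mulr_ge0// sqr_ge0.
    lra.
  have h1 := ler_normB (f s) (f t); have h2 := fM t t01; have h3 := fM s s01'.
  have hst : (d / 2) ^+ 2 <= (s - t) ^+ 2.
    by rewrite -(real_normK (num_real (s - t))) lerXn2r ?nnegrE//; lra.
  have h4 : C * (d / 2) ^+ 2 <= C * (s - t) ^+ 2 by rewrite ler_wpM2l.
  have h5 : 8 * M < C * d ^+ 2 by rewrite -ltr_pdivrMr// exprn_gt0.
  have h6 : C * (d / 2) ^+ 2 = C * d ^+ 2 / 4 by field.
  lra.
move=> [A [_ hA]]; exists (`|A| + 1); first by rewrite addr_ge0.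
move=> s t s01 t01; apply: (hA (`|A| + 1)) => //.
  by rewrite (le_lt_trans (ler_norm A))// ltrDl.
Qed.

Lemma uniform_cvgP (A : set R) (F : nat -> R -> R) (f : R -> R) :
  {uniform A, F @ \oo --> f} <->
  forall e : R, 0 < e ->
    \forall n \near \oo, forall x, A x -> `|f x - F n x| <= e.
Proof.
split=> [FA e e0|FA U /uniform_nbhs[E [entE EU]]].
  suff : nbhs (f : {uniform` A -> R})
      [set h : {uniform` A -> R} | forall x, A x -> `|f x - h x| <= e].
    by move=> /FA.
  apply/uniform_nbhs; exists [set xy | ball xy.1 e xy.2]; split.
    exact: (entourage_ball _ (PosNum e0)).
  by move=> h /= hE y /hE /ltW.
move: entE; rewrite -entourage_ballE => -[e /= e0 eE].
have e20 : 0 < e / 2 by rewrite divr_gt0.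
apply: filterS (FA _ e20) => n hn; apply: EU => y /hn fy.
by apply: eE => /=; rewrite /ball/=; lra.
Qed.

End ContinuousFunctions.

(** * The weights of the operator of a fixed order *)

Section FixedOrder.
Set Implicit Arguments.
Unset Strict Implicit.
Context (R : realType) (Q : nat -> {poly R}) (w : nat -> nat -> R) (m : nat).
Hypothesis wpos : forall k : nat, (k <= m)%N -> 0 < w m k.

Local Notation g := (bern_gamma w m).
Local Notation g' := (bern_gamma_pred w m).
Local Notation node := (rbern_node w m.+1).

Lemma bern_gamma_gt0 k : (k <= m)%N -> 0 < g k.
Proof. by move=> km; rewrite mulr_gt0 ?wpos// ltr0n bin_gt0. Qed.

Lemma bern_gammaS : g m.+1 = 0.
Proof. by rewrite /bern_gamma bin_small// mulr0. Qed.

Lemma bern_gamma_ge0 k : (k <= m.+1)%N -> 0 <= g k.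
Proof.
rewrite leq_eqVlt ltnS => /orP[/eqP->|km]; first by rewrite bern_gammaS.
exact/ltW/bern_gamma_gt0.
Qed.

Lemma bern_gamma_pred_ge0 k : (k <= m.+1)%N -> 0 <= g' k.
Proof. by case: k => //= k km; exact/ltW/bern_gamma_gt0. Qed.

Lemma bern_gammaD_gt0 k : (k <= m.+1)%N -> 0 < g k + g' k.
Proof.
case: k => [|k km]; first by rewrite addr0 => _; exact: bern_gamma_gt0.
by rewrite ltr_wpDl ?bern_gamma_ge0//; exact: bern_gamma_gt0.
Qed.

Lemma rbern_node_itv k : (k <= m.+1)%N -> 0 <= node k <= 1.
Proof.
move=> km; have g0 := bern_gammaD_gt0 km.
rewrite divr_ge0 ?bern_gamma_pred_ge0 ?(ltW g0)//=.
by rewrite ler_pdivrMr// mul1r lerDr bern_gamma_ge0.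
Qed.

Definition rbern_weight (x : R) (k : nat) : R :=
  (g k + g' k) * (x ^+ k * (1 - x) ^+ (m.+1 - k) / (Q m).[x]).

Definition bern_weight (x : R) (k : nat) : R :=
  g k * (x ^+ k * (1 - x) ^+ (m - k) / (Q m).[x]).

Local Notation p := rbern_weight.
Local Notation b := bern_weight.

Lemma rbern_opE (f : R -> R) (x : R) :
  rbern_op Q w m.+1 f x = \sum_(k < m.+2) f (node k) * p x k.
Proof. by apply: eq_bigr => k _; rewrite -mulrA. Qed.

Lemma node_weight (x : R) k : (k <= m.+1)%N ->
  node k * p x k = g' k * (x ^+ k * (1 - x) ^+ (m.+1 - k) / (Q m).[x]).
Proof.
by move=> km; rewrite /rbern_weight mulrA divfK// gt_eqF// bern_gammaD_gt0.
Qed.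

(** The factor [node k] cancels the denominator of [p x k], leaving
    [x * b x k.-1]; the term of index 0 vanishes. This and the next lemma are
    the only facts about the nodes that enter the moment computations. *)
Lemma sum_node_weight (h : nat -> R) (x : R) :
  \sum_(k < m.+2) h k * (node k * p x k) = x * \sum_(k < m.+1) h k.+1 * b x k.
Proof.
rewrite big_ord_recl node_weight//= mul0r mulr0 add0r mulr_sumr.
apply: eq_bigr => k _; rewrite node_weight//= subSS exprS /bern_weight.
by ring.
Qed.

(** The mirror image: [(1 - node k) * p x k = (1 - x) * b x k], where the term
    of index [m.+1] vanishes. *)
Lemma sum_onem_node_weight (h : nat -> R) (x : R) :
  \sum_(k < m.+2) h k * ((1 - node k) * p x k)
  = (1 - x) * \sum_(k < m.+1) h k * b x k.
Proof.
have E k : (k <= m.+1)%N -> (1 - node k) * p x k =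
    g k * (x ^+ k * (1 - x) ^+ (m.+1 - k) / (Q m).[x]).
  by move=> km; rewrite mulrBl mul1r node_weight// -mulrBl addrK.
rewrite big_ord_recr/= E// bern_gammaS mul0r mulr0 addr0 mulr_sumr.
apply: eq_bigr => k _; have km : (k <= m)%N by rewrite -ltnS.
by rewrite E 1?ltnW// subSn// exprS /bern_weight; ring.
Qed.

(** * The variance of the weights at a point *)

Section Point.
Context (x : R).
Hypothesis x01 : 0 <= x <= 1.
Hypothesis Qx : 0 < (Q m).[x].
Hypothesis coef : bernstein_coefs m (Q m) (w m).

Let monomial_ge0 i j : 0 <= x ^+ i * (1 - x) ^+ j / (Q m).[x].
Proof.
have /andP[x0 x1] := x01.
by rewrite divr_ge0 ?mulr_ge0 ?exprn_ge0 ?(ltW Qx)// subr_ge0.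
Qed.

Lemma rbern_weight_ge0 k : (k <= m.+1)%N -> 0 <= p x k.
Proof. by move=> km; rewrite mulr_ge0// ltW// bern_gammaD_gt0. Qed.

Lemma bern_weight_ge0 k : (k <= m)%N -> 0 <= b x k.
Proof. by move=> km; rewrite mulr_ge0// ltW// bern_gamma_gt0. Qed.

(** This is the Bernstein expansion of [Q m] at [x], divided by [(Q m).[x]]. *)
Lemma sum_bern_weight : \sum_(k < m.+1) b x k = 1.
Proof.
under eq_bigr do rewrite /bern_weight mulrA.
rewrite -mulr_suml; apply: canLR (mulfK (lt0r_neq0 Qx)) _.
rewrite mul1r [in RHS]coef horner_sum; apply: eq_bigr => k _.
by rewrite !hornerE.
Qed.

Lemma sum_rbern_weight : \sum_(k < m.+2) p x k = 1.
Proof.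
have sum1 : \sum_(k < m.+1) 1 * b x k = 1.
  by rewrite -[RHS]sum_bern_weight; apply: eq_bigr => k _; rewrite mul1r.
have -> : \sum_(k < m.+2) p x k = \sum_(k < m.+2) 1 * (node k * p x k)
    + \sum_(k < m.+2) 1 * ((1 - node k) * p x k).
  by rewrite -big_split; apply: eq_bigr => k _ /=; ring.
rewrite (sum_node_weight (fun=> 1)) (sum_onem_node_weight (fun=> 1)) sum1; ring.
Qed.

Lemma sum_rbern_weight_node : \sum_(k < m.+2) node k * p x k = x.
Proof.
rewrite -[RHS]mulr1 -[in RHS]sum_bern_weight.
have -> : \sum_(k < m.+1) b x k = \sum_(k < m.+1) 1 * b x k.
  by apply: eq_bigr => k _; rewrite mul1r.
rewrite -(sum_node_weight (fun=> 1)).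
by apply: eq_bigr => k _; rewrite mul1r.
Qed.

Definition rbern_variance : R := \sum_(k < m.+2) (node k - x) ^+ 2 * p x k.

Lemma rbern_op_sqr :
  rbern_op Q w m.+1 (fun t => t ^+ 2) x - x ^+ 2 = rbern_variance.
Proof.
rewrite rbern_opE /rbern_variance.
have -> : \sum_(k < m.+2) (node k - x) ^+ 2 * p x k =
    \sum_(k < m.+2) node k ^+ 2 * p x k - 2 * x * \sum_(k < m.+2) node k * p x k
    + x ^+ 2 * \sum_(k < m.+2) p x k.
  by rewrite !mulr_sumr -sumrB -big_split; apply: eq_bigr => k _ /=; ring.
rewrite sum_rbern_weight_node sum_rbern_weight; ring.
Qed.

(** With [A] and [B] the means of [node k.+1] and [node k] under [b x], the
    second moment of [p x] is [x * A]; splitting the mean of [p x] gives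
    [x - x * A = (1 - x) * B], which turns [x * A - x ^+ 2] into
    [x * (1 - x) * (A - B)]. *)
Lemma rbern_varianceE :
  rbern_variance
  = x * (1 - x) * \sum_(k < m.+1) (node k.+1 - node k) * b x k.
Proof.
pose A := \sum_(k < m.+1) node k.+1 * b x k.
pose B := \sum_(k < m.+1) node k * b x k.
have sqrE : \sum_(k < m.+2) node k ^+ 2 * p x k = x * A.
  by rewrite -sum_node_weight; apply: eq_bigr => k _; ring.
have meanE : x - x * A = (1 - x) * B.
  rewrite -sqrE -sum_onem_node_weight -[X in X - _]sum_rbern_weight_node -sumrB.
  by apply: eq_bigr => k _; ring.
have -> : \sum_(k < m.+1) (node k.+1 - node k) * b x k = A - B.
  by rewrite -sumrB; apply: eq_bigr => k _; ring.
have -> : x * (1 - x) * (A - B) = x * (1 - x) * A - x * ((1 - x) * B) by ring.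
by rewrite -rbern_op_sqr rbern_opE sqrE -meanE; ring.
Qed.

(** In the closed form the sum is an average of gaps, and
    [x * (1 - x) <= 1 / 4]. *)
Lemma rbern_variance_le (d : R) :
  (forall k, (k <= m)%N -> `|node k.+1 - node k| <= d) ->
  rbern_variance <= d / 4.
Proof.
move=> hd; rewrite rbern_varianceE; have /andP[x0 x1] := x01.
have sum_le : \sum_(k < m.+1) (node k.+1 - node k) * b x k <= d.
  rewrite -[leRHS]mulr1 -sum_bern_weight mulr_sumr; apply: ler_sum => k _.
  have km : (k <= m)%N by rewrite -ltnS.
  by rewrite ler_wpM2r ?bern_weight_ge0// (le_trans (ler_norm _))// hd.
have d0 : 0 <= d.
  exact: le_trans (normr_ge0 _) (hd 0%N (leq0n m)).
have h1 : x * (1 - x) * \sum_(k < m.+1) (node k.+1 - node k) * b x k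
    <= x * (1 - x) * d.
  by rewrite ler_wpM2l// mulr_ge0// subr_ge0.
(* Expanding, this is [x * (1 - x) * d <= d / 4]. *)
have h2 : 0 <= d * (x - 1 / 2) ^+ 2 by rewrite mulr_ge0// sqr_ge0.
nra.
Qed.

Lemma rbern_variance_ge (r : R) : 0 <= r ->
  (forall k, (k <= m.+1)%N -> r <= `|node k - x|) -> r ^+ 2 <= rbern_variance.
Proof.
move=> r0 hr; rewrite -[leLHS]mulr1 -sum_rbern_weight mulr_sumr.
apply: ler_sum => k _; have km : (k <= m.+1)%N by rewrite -ltnS.
rewrite ler_wpM2r ?rbern_weight_ge0//.
by rewrite -[leRHS](real_normK (num_real _)) lerXn2r ?nnegrE ?hr.
Qed.

(** Averaging the assumed bound against the weights: its quadratic term becomes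
    the variance. *)
Lemma rbern_op_error (f : R -> R) (e C : R) :
  (forall s t : R, 0 <= s <= 1 -> 0 <= t <= 1 ->
     `|f s - f t| <= e + C * (s - t) ^+ 2) ->
  `|f x - rbern_op Q w m.+1 f x| <= e + C * rbern_variance.
Proof.
move=> hf; rewrite rbern_opE /rbern_variance.
rewrite -[X in `|X - _|]mulr1 -[e]mulr1 -sum_rbern_weight !mulr_sumr.
rewrite -sumrB -big_split; apply: le_trans (ler_norm_sum _ _ _) _.
apply: ler_sum => k _; have km : (k <= m.+1)%N by rewrite -ltnS.
have p0 := rbern_weight_ge0 km.
rewrite /= -mulrBl normrM (ger0_norm p0) mulrA -mulrDl ler_wpM2r//.
by rewrite distrC hf// rbern_node_itv.
Qed.

End Point.

(** * Gaps and monotonicity of the nodes *)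

Lemma node_gap_ge k : (k <= m)%N -> `|node k.+1 - node k| <= node_gap w m.+1.
Proof.
move=> km; apply: ub_le_sup; last by exists k.
exists 1 => _ [i /= im <-].
have := rbern_node_itv im; have := rbern_node_itv (ltnW im).
by rewrite ler_norml; lra.
Qed.

Lemma node_gap_le (d : R) :
  (forall k, (k <= m)%N -> `|node k.+1 - node k| <= d) -> node_gap w m.+1 <= d.
Proof.
move=> hd; apply: ge_sup; first by exists `|node 1 - node 0|, 0%N.
by move=> _ [k /= km <-]; exact: hd.
Qed.

Section Monotone.
Hypothesis W : property_W w m.+1.

(** In the interior this is property (W), whose right-hand side at [k] is
    exactly ['C(m, k) ^+ 2 / ('C(m, k.-1) * 'C(m, k.+1))]. At [k = 0] and
    [k = m] one factor on the left is zero by convention. *)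
Lemma bern_gamma_log_concave k : (k <= m)%N -> g' k * g k.+1 <= g k ^+ 2.
Proof.
case: k => [_|k km]; first by rewrite mul0r sqr_ge0.
move: km; rewrite leq_eqVlt => /orP[/eqP->|ltkm].
  by rewrite bern_gammaS mulr0 sqr_ge0.
have [e me] : exists e, m = (e.+2 + k)%N.
  by exists (m - k.+2)%N; rewrite !addSnnS subnK.
have Wk : w m k * w m k.+2 / w m k.+1 ^+ 2
    < (k.+2%:R / k.+1%:R) * (e.+2%:R / e.+1%:R).
  have -> : e.+2 = (m.+1 - k.+1)%N by rewrite subSS me addnK.
  have -> : e.+1 = (m.+1 - k.+1 - 1)%N by rewrite subSS me addnK subn1.
  by apply: (W (k := k.+1)); rewrite /= subSS me subn1 /= ltnS leq_addl.
have bin1 : k.+1%:R * 'C(m, k.+1)%:R = e.+2%:R * 'C(m, k)%:R :> R.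
  by rewrite -!natrM mul_bin_left me addnK.
have bin2 : k.+2%:R * 'C(m, k.+2)%:R = e.+1%:R * 'C(m, k.+1)%:R :> R.
  by rewrite -!natrM mul_bin_left me addSnnS addnK.
rewrite /= /bern_gamma.
have k1 : 0 < k.+1%:R :> R by rewrite ltr0n.
have k2 : 0 < k.+2%:R :> R by rewrite ltr0n.
have e1 : 0 < e.+1%:R :> R by rewrite ltr0n.
have e2 : 0 < e.+2%:R :> R by rewrite ltr0n.
have z0 : 0 < w m k.+1 by rewrite wpos// ltnW.
have -> : 'C(m, k)%:R = k.+1%:R * 'C(m, k.+1)%:R / e.+2%:R :> R.
  by rewrite bin1 mulrAC divff ?mul1r// gt_eqF.
have -> : 'C(m, k.+2)%:R = e.+1%:R * 'C(m, k.+1)%:R / k.+2%:R :> R.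
  by rewrite -bin2 mulrAC divff ?mul1r// gt_eqF.
move: Wk; rewrite ltr_pdivrMr ?exprn_gt0// => /ltW Wk.
(* Multiplying [Wk] by this factor gives the goal. *)
have c0 : 0 <= 'C(m, k.+1)%:R ^+ 2
    * (k.+1%:R * e.+1%:R / (e.+2%:R * k.+2%:R)) :> R.
  by rewrite mulr_ge0 ?sqr_ge0// divr_ge0// mulr_ge0// ltW.
have := ler_wpM2l c0 Wk; congr (_ <= _); field; rewrite !gt_eqF//.
Qed.

(** Clearing denominators, this is log-concavity of the [gamma_k]. *)
Lemma rbern_nodeS k : (k <= m)%N -> node k <= node k.+1.
Proof.
move=> km; have h0 := @bern_gammaD_gt0 k; have h1 := @bern_gammaD_gt0 k.+1.
rewrite /rbern_node/= ler_pdivrMr ?h0 1?ltnW//.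
rewrite mulrAC ler_pdivlMr ?h1//=.
have := bern_gamma_log_concave km; lra.
Qed.

Lemma rbern_node_le i j : (i <= j)%N -> (j <= m.+1)%N -> node i <= node j.
Proof.
elim: j => [|j IH]; first by rewrite leqn0 => /eqP->.
rewrite leq_eqVlt => /orP[/eqP->//|ij] jm.
exact: le_trans (IH ij (ltnW jm)) (rbern_nodeS jm).
Qed.

(** The nodes being ordered, none lies strictly between two consecutive ones, so
    none is closer to their midpoint than these two. *)
Lemma rbern_node_far k i : (k <= m)%N -> (i <= m.+1)%N ->
  (node k.+1 - node k) / 2 <= `|node i - (node k + node k.+1) / 2|.
Proof.
move=> km im; have [ik|ki] := leqP i k.
  have := rbern_node_le ik (leqW km); rewrite ler_normr; lra.
have := rbern_node_le ki im; rewrite ler_normr; lra.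
Qed.

End Monotone.
End FixedOrder.

(** * Convergence of the operators *)

Theorem corollary5 (R : realType) (Q : nat -> {poly R}) (w : nat -> nat -> R)
    (hdeg : forall n : nat, (1 <= n)%N -> (size (Q n.-1) <= n)%N)
    (hQpos : forall (n : nat) (x : R),
       (1 <= n)%N -> 0 <= x <= 1 -> 0 < (Q n.-1).[x])
    (hcoef : forall n : nat, (1 <= n)%N -> bernstein_coefs n.-1 (Q n.-1) (w n.-1))
    (hwpos : forall n k : nat, (1 <= n)%N -> (k <= n - 1)%N -> 0 < w n.-1 k)
    (hW : forall n : nat, (1 <= n)%N -> property_W w n) :
  (forall f : R -> R, {within `[0, 1], continuous f} ->
     {uniform `[0, 1], (fun n : nat => rbern_op Q w n f) @ \oo --> f})
  <->
  (node_gap w n @[n --> \oo] --> (0 : R)).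
Proof.
have wpos m k : (k <= m)%N -> 0 < w m k.
  by move=> km; apply: (hwpos m.+1) => //; rewrite subn1.
have Qpos m x : 0 <= x <= 1 -> 0 < (Q m).[x] by exact: (hQpos m.+1).
have coef m : bernstein_coefs m (Q m) (w m) by exact: (hcoef m.+1).
split=> [Rcvg|gap0 f fcont].
  have sqr_cont : {within `[0, 1], continuous (fun t : R => t ^+ 2)}.
    by apply: continuous_subspaceT => t; exact: exprn_continuous.
  apply/cvgrPdist_le => e e0.
  have e20 : 0 < (e / 2) ^+ 2 by rewrite exprn_gt0// divr_gt0.
  have /uniform_cvgP/(_ _ e20) sqr_near := Rcvg _ sqr_cont.
  apply: filterS2 (nbhs_infty_gt 0) sqr_near => -[//|m] _ hm.
  have gap_ge0 : 0 <= node_gap w m.+1.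
    exact: le_trans (normr_ge0 _) (node_gap_ge (wpos m) (leq0n m)).
  rewrite sub0r normrN ger0_norm//.
  apply: node_gap_le => k km.
  have mono := rbern_nodeS (wpos m) (hW m.+1 isT) km.
  rewrite ger0_norm ?subr_ge0//.
  pose x := (rbern_node w m.+1 k + rbern_node w m.+1 k.+1) / 2.
  have x01 : 0 <= x <= 1.
    have := rbern_node_itv (wpos m) (leqW km).
    have := rbern_node_itv (wpos m) (k := k.+1) km.
    by rewrite /x; lra.
  have half_gap : 0 <= (rbern_node w m.+1 k.+1 - rbern_node w m.+1 k) / 2.
    by rewrite divr_ge0// subr_ge0.
  have far i : (i <= m.+1)%N ->
      (rbern_node w m.+1 k.+1 - rbern_node w m.+1 k) / 2
      <= `|rbern_node w m.+1 i - x|.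
    move=> im; exact: (rbern_node_far (wpos m) (hW m.+1 isT) km im).
  have := rbern_variance_ge (wpos m) x01 (Qpos m x x01) (coef m) half_gap far.
  rewrite -(rbern_op_sqr (wpos m) (Qpos m x x01) (coef m)) => var_ge.
  have sqr_le : ((rbern_node w m.+1 k.+1 - rbern_node w m.+1 k) / 2) ^+ 2
      <= (e / 2) ^+ 2.
    apply: le_trans var_ge _; apply: le_trans (ler_norm _) _.
    by rewrite distrC; apply: hm; rewrite /= in_itv.
  move: sqr_le; rewrite ler_pXn2r ?nnegrE ?(divr_ge0 (ltW e0))//; lra.
apply/uniform_cvgP => e e0.
have e20 : 0 < e / 2 by rewrite divr_gt0.
have [C C0 hC] := quadratic_modulus fcont e20.
(* The [+ 1] keeps the denominator nonzero when [C = 0]. *)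
have d0 : 0 < e / (C + 1) by rewrite divr_gt0// ltr_wpDl.
move/cvgrPdist_le : gap0 => /(_ _ d0) gap_near.
apply: filterS2 (nbhs_infty_gt 0) gap_near => -[//|m] _.
rewrite sub0r normrN => gap_le x; rewrite /= in_itv/= => x01.
have := rbern_op_error (wpos m) x01 (Qpos m x x01) (coef m) hC.
move=> /le_trans; apply.
have var_le : rbern_variance Q w m x <= e / (C + 1) / 4.
  apply: (rbern_variance_le (wpos m) x01 (Qpos m x x01) (coef m)) => k km.
  by rewrite (le_trans (node_gap_ge (wpos m) km))// (le_trans (ler_norm _)).
have C1 : 0 < C + 1 by rewrite ltr_wpDl.
have Cvar : C * rbern_variance Q w m x <= C * (e / (C + 1) / 4).
  by rewrite ler_wpM2l.
have CE : C * (e / (C + 1) / 4) <= e / 2.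
  rewrite -subr_ge0.
  have -> : e / 2 - C * (e / (C + 1) / 4) = e * (C + 2) / (4 * (C + 1)).
    by field; rewrite gt_eqF.
  by rewrite divr_ge0 ?mulr_ge0 ?addr_ge0 ?(ltW e0) ?(ltW C1).
lra.
Qed.
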